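(* Let $\mathcal T$ be a set of tile designs for the regular octahedron with symmetry group the full octahedral group $O_h$ (order $48$). Suppose there are $t_{\mathrm{id}}$ tiles, $t_f$ of which are fixed under (horizontal) reflection of the triangular face and $t_r$ of which are fixed under $120^\circ$ rotation of the face. Then the number of ways of tiling the faces of the octahedron up to full octahedral symmetry $O_h$ is $$\frac{1}{48}\left(t_{\mathrm{id}}^8+6t_{\mathrm{id}}^2+3t_{\mathrm{id}}^4+8t_{\mathrm{id}}^2t_r^2+6t_{\mathrm{id}}^4+t_{\mathrm{id}}^4+6t_{\mathrm{id}}^2+3t_{\mathrm{id}}^4+8t_{\mathrm{id}}t_r+6t_{\mathrm{id}}^2t_f^4\right)$$ $$=\frac{1}{48}\left(t_{\mathrm{id}}^8+13t_{\mathrm{id}}^4+12t_{\mathrm{id}}^2+8t_{\mathrm{id}}^2t_r^2+8t_{\mathrm{id}}t_r+6t_{\mathrm{id}}^2t_f^4\right).$$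
   Context: Tilings. Let $P$ be a polyhedron with set of faces $\mathcal F$ and let $\mathcal A$ be a group of isometries of $P$, acting on $\mathcal F$. A set of tile designs is a finite set $\mathcal T$ together with a group action of $\mathcal A$ on $\mathcal T\times\mathcal F$ lying over the action on $\mathcal F$ (so $A\cdot(T,F)=(T',A\cdot F)$ for some $T'\in\mathcal T$). A tiling is a map $\tau:\mathcal F\to\mathcal T$; $\mathcal A$ acts on tilings by moving graphs: $A\cdot\tau$ is the tiling with $((A\cdot\tau)(A\cdot F),A\cdot F)=A\cdot(\tau(F),F)$ for all $F$. The number of ways of tiling up to $\mathcal A$ is the number of $\mathcal A$-orbits on the set of tilings. The induced symmetry group $G$ of a face $F$ is the group of isometries of $F$ realized by elements of the stabilizer $\mathcal A_F$; for $g\in G$, $t_g$ is the number of $T\in\mathcal T$ with $g\cdot(T,F)=(T,F)$, where $g$ acts via the element of $\mathcal A_F$ inducing it. Since $\mathcal A$ acts transitively on faces, $t_g$ does not depend on the choice of $F$. In particular $t_{\mathrm{id}}=|\mathcal T|$. Polyhedron and group. Here $\mathcal A=O_h$ is the group of order $48$ of all $3\times3$ signed permutation matrices. The octahedron is the convex hull of the $O_h$-orbit of $(1,0,0)$ ($6$ vertices, $8$ equilateral triangular faces). The induced symmetry group of a face is $D_3=\langle r,f\mid r^3=f^2=(rf)^2=e\rangle$, with $r$ a $120^\circ$ rotation and $f$ a reflection of the triangle. *)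

(* Defs.v *)
From mathcomp Require Import all_boot all_order all_algebra all_fingroup.
From mathcomp Require Import boolp classical_sets functions cardinality reals.

Set Implicit Arguments.
Unset Strict Implicit.
Unset Printing Implicit Defensive.

Import Order.TTheory GRing.Theory Num.Theory.

Local Open Scope classical_set_scope.
Local Open Scope ring_scope.

Section Polyhedra.
Variable R : realType.
Notation V := 'cV[R]_3.
Implicit Types (P S F : set V) (A : 'M[R]_3).

Definition dot (u v : V) : R := \sum_i u i 0 * v i 0.

Definition convex_hull S : set V :=
  [set x | exists n (p : 'I_n -> V) (w : 'I_n -> R),
     [/\ forall i, S (p i), forall i, 0 <= w i,
         \sum_i w i = 1 & x = \sum_i w i *: p i]].

(* The 2-dimensional faces of P: intersections of P with a supporting plane
   that contain three affinely independent points. *)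
Definition faces P : set (set V) :=
  [set F | exists (c : V) (m : R),
     [/\ c != 0, forall x, P x -> dot c x <= m,
         F = P `&` [set x | dot c x = m]
       & exists p q r : V,
           [/\ F p, F q, F r & \rank (row_mx (q - p) (r - p)) = 2%N]]].

(* [g] restricts to [F] as a rotation through 120 degrees, in either sense,
   about a point [c] of [F]: x - c and g x - c have equal length and make an
   angle of cosine -1/2. *)
Definition rotates120 F (g : V -> V) : Prop :=
  exists2 c, F c & forall x, F x ->
    dot (g x - c) (g x - c) = dot (x - c) (x - c) /\
    dot (g x - c) (x - c) = - 2^-1 * dot (x - c) (x - c).

(* [g] restricts to [F] as the reflection in the line of the plane of [F]
   through [c] with normal [p - q]; taking p, q in F makes the normal parallel
   to that plane. *)
Definition reflects F (g : V -> V) : Prop :=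
  exists c p q, [/\ F c, F p, F q, p != q &
    forall x, F x ->
      g x = x - (2 * dot (x - c) (p - q) / dot (p - q) (p - q)) *: (p - q)].

Definition signed_perm_mx : set 'M[R]_3 :=
  [set A | exists (d : 'rV[R]_3) (s : 'S_3),
     (forall i, d 0 i = 1 \/ d 0 i = -1) /\ A = diag_mx d *m perm_mx s].

Definition octahedron : set V :=
  convex_hull [set A *m delta_mx 0 0 | A in signed_perm_mx].

Definition stabilizer (G : set 'M[R]_3) F : set 'M[R]_3 :=
  [set A | G A /\ mulmx A @` F = F].

End Polyhedra.

Arguments signed_perm_mx : clear implicits.
Arguments octahedron : clear implicits.

Section Tilings.
Variables (R : realType) (P : set 'cV[R]_3) (G : set 'M[R]_3) (T : finType).
Variable act : 'M[R]_3 -> T * faces P -> T * faces P.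

(* Only the values of [act] on G are constrained. *)
Record tile_designs : Prop := TileDesigns {
  tile_act1 : forall p, act 1%:M p = p;
  tile_actM : forall A B, G A -> G B ->
    forall p, act (A *m B) p = act A (act B p);
  tile_act_over : forall A, G A -> forall p,
    val (act A p).2 = mulmx A @` val p.2 }.

Definition tiling := faces P -> T.

Definition graph_of (tau : tiling) : set (T * faces P) :=
  [set p | p.1 = tau p.2].

Definition tiling_orbit (tau : tiling) : set tiling :=
  [set tau' | exists2 A, G A & graph_of tau' = act A @` graph_of tau].

Definition tiling_orbits : set (set tiling) := range tiling_orbit.

Definition fixed_tiles (A : 'M[R]_3) (F : faces P) : nat :=
  #|[pred t : T | `[< act A (t, F) = (t, F) >]]|.

End Tilings.

(* Main.v *)
Require Import Defs.
From HB Require Import structures.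
From mathcomp Require Import all_boot all_order all_algebra all_fingroup.
From mathcomp Require Import boolp classical_sets functions cardinality reals.
From mathcomp Require Import ring lra.

(** The formula is Burnside's lemma for the group O_h acting on tilings.

    A signed permutation matrix moves the coordinate axes and flips some of
    them, so O_h is modelled by the finite group [Oh] of pairs (signs,
    permutation of the three axes), and the eight faces by the eight octants,
    the face of an octant being cut out of the octahedron by the plane
    s.x = 1 for the sign vector s.  Geometry enters in three ways only: these
    eight sets are all the faces ([faceP]), a rotation of a face through 120
    degrees is an element of order 3 of its stabilizer
    ([rotates120_turn_order]), and a reflection is one of order 2
    ([reflects_turn_order]).

    A tiling fixed by g is determined by its values on one face in each
    g-cycle of faces, and the value at a face F of a cycle of length n can be
    any tile fixed by g^n, which lies in the stabilizer of F; so the number of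
    fixed tilings is a product over cycles ([card_fixed_sections]).  Every
    stabilizer is a copy of D_3, and all pairs (face, rotation of order 3
    stabilizing it) are conjugate in O_h, as are all pairs (face, reflection
    stabilizing it).  Hence each factor is the total number of tiles, t_f or
    t_r according to whether g^n has order 1, 2 or 3 ([tile_fixE]).  Listing
    the orders found along the cycles of each of the 48 elements is a finite
    computation ([cycle_types]), whose outcome has one summand of the stated
    polynomial for each conjugacy class of O_h. *)

Import Order.TTheory GRing.Theory Num.Theory.
Local Open Scope ring_scope.

(** * The group of signed permutations of the axes *)

Lemma in_ord3 (i : 'I_3) : i \in [:: 0; 1; 2].
Proof. by case: i => [[|[|[|//]]]]. Qed.

(** The three components are the signs of the coordinates, with [true] for a
    negative one.  Triples are used instead of finite functions because they
    can be enumerated and compared by computation. *)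
Definition octant := (bool * bool * bool)%type.

Definition osign (s : octant) (i : 'I_3) : bool :=
  nth false [:: s.1.1; s.1.2; s.2] i.

Definition octant_of (b : 'I_3 -> bool) : octant := (b 0, b 1, b 2).

Lemma osignE b i : osign (octant_of b) i = b i.
Proof. by have := in_ord3 i; rewrite !inE => /or3P[] /eqP->. Qed.

Lemma osign_inj s t : osign s =1 osign t -> s = t.
Proof.
case: s t => [[a b] c] [[a' b'] c'] e.
by rewrite (e 0 : a = a') (e 1 : b = b') (e 2 : c = c').
Qed.

(** The element (d, (k, b)) is the map whose value at x has i-th coordinate
    (-1)^d_i x_(k + i), or (-1)^d_i x_(k - i) when b holds: modulo 3 every
    permutation of the three axes is a translation or a point reflection. *)
Definition Oh := (octant * ('I_3 * bool))%type.
HB.instance Definition _ := Finite.on Oh.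

Definition axis (g : Oh) (i : 'I_3) : 'I_3 :=
  if g.2.2 then g.2.1 - i else g.2.1 + i.

Definition oct_move (g : Oh) (s : octant) : octant :=
  octant_of (fun i => osign g.1 i (+) osign s (axis g i)).

Lemma osign_moveE g s i :
  osign (oct_move g s) i = osign g.1 i (+) osign s (axis g i).
Proof. exact: osignE. Qed.

Definition Oh_mul (g h : Oh) : Oh :=
  (oct_move g h.1, (axis h g.2.1, g.2.2 (+) h.2.2)).

Definition Oh_one : Oh := ((false, false, false), (0, false)).

Definition Oh_inv (g : Oh) : Oh :=
  let p := (if g.2.2 then g.2.1 else - g.2.1, g.2.2) in
  (oct_move (Oh_one.1, p) g.1, p).

Lemma axis_mul g h i : axis (Oh_mul g h) i = axis h (axis g i).
Proof.
rewrite /Oh_mul /axis /=; case: g.2.2; case: h.2.2 => /=;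
  by rewrite ?opprD ?opprK ?addrA.
Qed.

Lemma axis_inj g : injective (axis g).
Proof.
by move=> i j; rewrite /axis; case: g.2.2 => /addrI // /oppr_inj.
Qed.

Lemma axis_onto (p : 'I_3 -> 'I_3) : injective p ->
  exists g2, forall d, axis (d, g2) =1 p.
Proof.
move=> p_inj; exists (p 0, p 1 != p 0 + 1) => d i; rewrite /axis /=.
have: (p 0 != p 1) && (p 0 != p 2) && (p 1 != p 2).
  by rewrite !(inj_eq p_inj).
have := in_ord3 i; rewrite !inE => /or3P[] /eqP->;
have := in_ord3 (p 0); have := in_ord3 (p 1); have := in_ord3 (p 2);
by rewrite !inE => /or3P[] /eqP-> /or3P[] /eqP-> /or3P[] /eqP-> //=;
  move=> _; apply/eqP.
Qed.

Section Matrix.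
Variable K : comNzRingType.

Definition Oh_mx (g : Oh) : 'M[K]_3 :=
  \matrix_(i, j) ((-1) ^+ osign g.1 i *+ (axis g i == j)).

Lemma Oh_mxE g n (B : 'M[K]_(3, n)) i j :
  (Oh_mx g *m B) i j = (-1) ^+ osign g.1 i * B (axis g i) j.
Proof.
rewrite mxE (bigD1 (axis g i)) //= mxE eqxx mulr1n big1 ?addr0 // => k ki.
by rewrite mxE eq_sym (negbTE ki) mulr0n mul0r.
Qed.

Lemma Oh_mx1 : Oh_mx Oh_one = 1%:M.
Proof.
apply/matrixP => i j; rewrite !mxE /axis /= add0r.
by have := in_ord3 i; rewrite !inE => /or3P[] /eqP->.
Qed.

Lemma Oh_mxM g h : Oh_mx (Oh_mul g h) = Oh_mx g *m Oh_mx h.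
Proof.
apply/matrixP => i j; rewrite Oh_mxE !mxE axis_mul osign_moveE.
by rewrite signr_addb mulrnAr.
Qed.

End Matrix.
Arguments Oh_mx : clear implicits.

Lemma Oh_mx_inj (K : numDomainType) : injective (Oh_mx K).
Proof.
move=> g h egh; have e i j := congr1 (fun A : 'M_3 => A i j) egh.
have eax i : axis g i = axis h i.
  apply/eqP; have := e i (axis h i); rewrite !mxE eqxx.
  by case: eqP => // _ /esym/eqP; rewrite signr_eq0.
have ed : g.1 = h.1.
  apply: osign_inj => i; have := e i (axis h i); rewrite !mxE eax eqxx.
  by move/signr_inj.
case: g h {egh e} eax ed => [d [k b]] [d' [k' b']] eax /= ->.
have ek : k = k'.
  by have := eax 0; rewrite /axis /=;
    case: (b) (b') => -[]; rewrite ?subr0 ?addr0.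
have := eax 1; rewrite -ek /axis /= => {ek}.
by case: b {eax}; case: b' => // /addrI /eqP.
Qed.

(** The group laws are those of matrices, read back through the faithful
    representation over the integers. *)
Lemma Oh_mulA : associative Oh_mul.
Proof. by move=> a b c; apply: (@Oh_mx_inj int); rewrite !Oh_mxM mulmxA. Qed.

Lemma Oh_mul1 : left_id Oh_one Oh_mul.
Proof. by move=> a; apply: (@Oh_mx_inj int); rewrite Oh_mxM Oh_mx1 mul1mx. Qed.

Lemma Oh_mulV : left_inverse Oh_one Oh_inv Oh_mul.
Proof.
move=> g; congr (_, (_, _)).
- apply: osign_inj => i; rewrite !osignE.
  by have := in_ord3 i; rewrite !inE => /or3P[] /eqP->; apply: addbb.
- by rewrite /axis /=; case: g.2.2; rewrite ?subrr.
- by rewrite /= addbb.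
Qed.

HB.instance Definition _ :=
  Finite_isGroup.Build Oh Oh_mulA Oh_mul1 Oh_mulV.

Lemma axisK g : cancel (axis g) (axis g^-1%g).
Proof.
move=> i; rewrite -axis_mul -[Oh_mul _ _]/(g * g^-1)%g mulgV.
by rewrite /axis /= add0r.
Qed.

Lemma oct_moveM (g h : Oh) s : oct_move (g * h)%g s = oct_move g (oct_move h s).
Proof.
apply: osign_inj => i; rewrite -[(g * h)%g]/(Oh_mul g h) !osign_moveE axis_mul.
by rewrite addbA.
Qed.

Lemma oct_move1 s : oct_move 1%g s = s.
Proof.
by apply: osign_inj => i; rewrite osign_moveE;
  have := in_ord3 i; rewrite !inE => /or3P[] /eqP->.
Qed.

Lemma oct_moveK g : cancel (oct_move g) (oct_move g^-1%g).
Proof. by move=> s; rewrite -oct_moveM mulVg oct_move1. Qed.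

(** * Counting the sections fixed by a bundle map *)

Section FixedSections.
Variables (S T : finType) (sigma rep : S -> S) (phi : T * S -> T * S).
Hypothesis sigma_inj : injective sigma.
Hypothesis phi_over : forall p, (phi p).2 = sigma p.2.
Hypothesis rep_conn : forall s, fconnect sigma (rep s) s.
Hypothesis rep_sigma : forall s, rep (sigma s) = rep s.

Definition fixed_section (tau : {ffun S -> T}) :=
  [forall s, phi (tau s, s) == (tau (sigma s), sigma s)].

Lemma iter_phi_over n p : (iter n phi p).2 = iter n sigma p.2.
Proof. by elim: n => //= n IHn; rewrite phi_over IHn. Qed.

Lemma fixed_section_iter tau : fixed_section tau ->
  forall n s, iter n phi (tau s, s) = (tau (iter n sigma s), iter n sigma s).
Proof.
move=> /forallP fix_tau; elim=> //= n IHn s.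
by rewrite IHn (eqP (fix_tau _)).
Qed.

(** When a full turn around the cycle of s fixes (t, s), the iterate of
    (t, s) lying over a point of the cycle depends on that point alone: two
    iterates over the same point differ by full turns. *)
Lemma iter_phi_closed t s : iter (fingraph.order sigma s) phi (t, s) = (t, s) ->
  forall n,
    iter n phi (t, s) = iter (findex sigma s (iter n sigma s)) phi (t, s).
Proof.
move=> closed n; set o := fingraph.order sigma s in closed.
have turns q : iter (q * o) phi (t, s) = (t, s).
  by elim: q => // q IHq; rewrite mulSn iterD IHq closed.
have sigma_turns : iter n sigma s = iter (n %% o) sigma s.
  rewrite {1}(divn_eq n o) addnC iterD.
  by have := iter_phi_over (n %/ o * o) (t, s); rewrite turns /= => <-.
rewrite sigma_turns findex_iter ?ltn_mod ?fingraph.order_gt0 //.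
by rewrite {1}(divn_eq n o) addnC iterD turns.
Qed.

Lemma rep_id s : rep (rep s) = rep s.
Proof.
have /iter_findex {2}<- := rep_conn s.
by elim: (findex _ _ _) => //= n IHn; rewrite rep_sigma.
Qed.

(** Restriction to the representatives is a bijection from the fixed sections
    to the families of values that close up after one turn: a fixed section is
    recovered by transporting its value at [rep s] along the cycle to s.  The
    transversal [rep] is arbitrary so that a computable one can be plugged
    in. *)
Lemma card_fixed_sections :
  #|[pred tau | fixed_section tau]| =
  (\prod_(s | rep s == s)
     #|[pred t | iter (fingraph.order sigma s) phi (t, s) == (t, s)]|)%N.
Proof.
pose reps := {s | rep s == s}.
pose fix_turn s := [pred t | iter (fingraph.order sigma s) phi (t, s) == (t, s)].
pose closed (u : reps) := fix_turn (val u).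
rewrite (big_sub [pred s | rep s == s] (fun s => #|fix_turn s|)).
transitivity #|family closed|; last by rewrite card_family foldrE big_image.
pose restr (tau : {ffun S -> T}) : {ffun reps -> T} := [ffun u => tau (val u)].
have rep_val (u : reps) : rep (val u) = val u by exact/eqP/(valP u).
pose Rep s : reps := exist _ (rep s) (introT eqP (rep_id s)).
have restr_inj : {in [pred tau | fixed_section tau] &, injective restr}.
  move=> tau tau'; rewrite !inE => fix_tau fix_tau' eq_restr; apply/ffunP => s.
  have eq_rep : tau (rep s) = tau' (rep s).
    by have /ffunP/(_ (Rep s)) := eq_restr; rewrite !ffunE.
  have /iter_findex def_s := rep_conn s.
  have := fixed_section_iter _ fix_tau (findex sigma (rep s) s) (rep s).
  by rewrite eq_rep (fixed_section_iter _ fix_tau') def_s => -[].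
rewrite -(card_in_image restr_inj); apply: eq_card => h.
apply/fintype.imageP/familyP => [[tau fix_tau ->] u | closed_h].
  by rewrite !inE ffunE fixed_section_iter // iter_order.
pose tau := [ffun s => (iter (findex sigma (rep s) s) phi (h (Rep s), rep s)).1].
have tauE n (u : reps) :
    iter n phi (h u, val u) = (tau (iter n sigma (val u)), iter n sigma (val u)).
  have closed_u : iter (fingraph.order sigma (val u)) phi (h u, val u) = (h u, val u).
    exact/eqP/(closed_h u).
  rewrite (iter_phi_closed _ _ closed_u) [LHS]surjective_pairing iter_phi_over /=.
  have rep_iter : rep (iter n sigma (val u)) = val u.
    by rewrite -[RHS]rep_val; elim: n => //= n IHn; rewrite rep_sigma.
  have -> : tau (iter n sigma (val u)) =
      (iter (findex sigma (val u) (iter n sigma (val u))) phi (h u, val u)).1.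
    by rewrite ffunE rep_iter; congr (iter _ _ (h _, _)).1; apply/val_inj.
  by rewrite iter_findex // fconnect_iter.
exists tau.
  apply/forallP => s; have /iter_findex def_s := rep_conn s.
  have := tauE (findex sigma (rep s) s) (Rep s).
  have := tauE (findex sigma (rep s) s).+1 (Rep s).
  by rewrite /= def_s => + e; rewrite e => ->.
by apply/ffunP => u; rewrite ffunE; have [] := tauE 0 u.
Qed.

End FixedSections.

(** * Cycles of the 48 elements on the octants *)

Definition octants : seq octant :=
  let bools := [:: false; true] in
  [seq (ab, c) | ab <- [seq (a, b) | a <- bools, b <- bools], c <- bools].

Definition Oh_elements : seq Oh :=
  let perms := [seq (k, b) | k <- [:: 0; 1; 2] : seq 'I_3,
                             b <- [:: false; true]] in
  [seq (d, p) | d <- octants, p <- perms].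

Lemma mem_octants s : s \in octants.
Proof. by case: s => [[[] []] []]. Qed.

Lemma mem_Oh_elements g : g \in Oh_elements.
Proof.
case: g => d [k b]; apply: allpairs_f; first exact: mem_octants.
by apply: allpairs_f; [exact: in_ord3 | case: b].
Qed.

Lemma all_octants (Q : pred octant) : all Q octants -> forall s, Q s.
Proof. by move=> /allP allQ s; apply/allQ/mem_octants. Qed.

Lemma all_Oh (Q : pred Oh) : all Q Oh_elements -> forall g, Q g.
Proof. by move=> /allP allQ g; apply/allQ/mem_Oh_elements. Qed.

Lemma enum_octants : perm_eq (index_enum octant) octants.
Proof.
apply: uniq_perm; [exact: index_enum_uniq | by [] | move=> s].
by rewrite mem_index_enum mem_octants.
Qed.

Lemma enum_Oh : perm_eq (index_enum Oh) Oh_elements.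
Proof.
apply: uniq_perm; [exact: index_enum_uniq | by vm_compute | move=> s].
by rewrite mem_index_enum mem_Oh_elements.
Qed.

Definition Oh_exp (g : Oh) n := iter n (Oh_mul g) Oh_one.

(** The length of the cycle of s under g.  Elements of the group have order at
    most 6, so the first return to s is among the first six iterates; the same
    bound serves in [cycle_rep]. *)
Definition period (g : Oh) (s : octant) : nat :=
  (index s (traject (oct_move g) (oct_move g s) 6)).+1.

Definition cycle_rep (g : Oh) (s : octant) : octant :=
  nth s octants (find [in traject (oct_move g) s 6] octants).

(** This is the order of g when g stabilizes an octant, since such elements
    form a copy of D_3. *)
Definition turn_order (g : Oh) : nat :=
  (if g == Oh_one then 1 else if Oh_mul g g == Oh_one then 2 else 3)%N.

(** The orders of the full turns of the cycles of g, with one entry for each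
    cycle; sorting makes the outcome independent of the choice of the
    representatives. *)
Definition cycle_type (g : Oh) : seq nat :=
  sort leq [seq turn_order (Oh_exp g (period g s)) |
            s <- octants & cycle_rep g s == s].

(** One line for each conjugacy class, in order: the identity, the rotations
    of order 4, their squares, the rotations of order 3, the half-turns about
    axes through midpoints of edges, and then the products of these five
    classes with the antipodal map. *)
Definition cycle_index : seq (seq nat) := (
     nseq 1 [:: 1; 1; 1; 1; 1; 1; 1; 1]
  ++ nseq 6 [:: 1; 1]
  ++ nseq 3 [:: 1; 1; 1; 1]
  ++ nseq 8 [:: 1; 1; 3; 3]
  ++ nseq 6 [:: 1; 1; 1; 1]
  ++ nseq 1 [:: 1; 1; 1; 1]
  ++ nseq 6 [:: 1; 1]
  ++ nseq 3 [:: 1; 1; 1; 1]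
  ++ nseq 8 [:: 1; 3]
  ++ nseq 6 [:: 1; 1; 2; 2; 2; 2])%N.

Lemma cycle_types : perm_eq [seq cycle_type g | g <- Oh_elements] cycle_index.
Proof. by vm_compute. Qed.

Lemma cycle_dataP g s :
  [&& uniq (traject (oct_move g) s (period g s)),
      iter (period g s) (oct_move g) s == s,
      cycle_rep g (oct_move g s) == cycle_rep g s
    & s \in traject (oct_move g) (cycle_rep g s) 6].
Proof.
move: s; apply: all_octants; move: g; apply: all_Oh.
by vm_compute.
Qed.

Lemma order_period g s : fingraph.order (oct_move g) s = period g s.
Proof.
have /and4P[+ + _ _] := cycle_dataP g s.
case: (period g s) (ltn0Sn _ : (0 < period g s)%N) => // n _ uniq_c /eqP closed.
rewrite (@order_cycle _ _ (traject (oct_move g) s n.+1))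
  ?size_traject ?mem_head //.
by apply/fpathP; exists n.+1; rewrite trajectSr -iterSr closed.
Qed.

Lemma cycle_rep_conn g s : fconnect (oct_move g) (cycle_rep g s) s.
Proof.
have /and4P[_ _ _ /trajectP[i _ {2}->]] := cycle_dataP g s.
exact: fconnect_iter.
Qed.

(** Two elements stabilizing the positive octant: the exchange of the second
    and third axes, and the cyclic permutation of the three axes. *)
Definition base_refl : Oh := ((false, false, false), (0, true)).
Definition base_rot : Oh := ((false, false, false), (1, false)).

(** O_h is transitive on the octants, and the three reflections in the
    stabilizer D_3 of an octant are conjugate in it, as are the two rotations
    of order 3. *)
Lemma stab_conj s g : oct_move g s == s ->
  [|| g == Oh_one
   | has (fun h => (oct_move h Oh_one.1 == s) &&
       (Oh_mul h (if turn_order g == 2%N then base_refl else base_rot)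
        == Oh_mul g h)) Oh_elements].
Proof.
apply: implyP; move: s; apply: all_octants; move: g; apply: all_Oh.
by vm_compute.
Qed.

Lemma derangement_turn_order g :
  all (fun i => axis g i != i) [:: 0; 1; 2] -> turn_order g = 3%N.
Proof.
move=> d; apply/eqP; move: d; apply: implyP.
by move: g; apply: all_Oh; vm_compute.
Qed.

(** * Counting orbits of tilings *)

Section Burnside.
Variables (T : finType) (phi : Oh -> T * octant -> T * octant).
Hypothesis phi1 : forall p, phi 1%g p = p.
Hypothesis phiM : forall g h p, phi (g * h)%g p = phi g (phi h p).
Hypothesis phi_over : forall g p, (phi g p).2 = oct_move g p.2.

Definition tile_fix (g : Oh) (s : octant) : nat :=
  #|[pred t | phi g (t, s) == (t, s)]|.

Lemma phi_pair g t s : phi g (t, s) = ((phi g (t, s)).1, oct_move g s).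
Proof. by rewrite [LHS]surjective_pairing phi_over. Qed.

(** The action of h carries the tiles at s fixed by g to the tiles at h s
    fixed by the conjugate of g. *)
Lemma tile_fix_conj g h s : oct_move g s = s ->
  tile_fix (h * g * h^-1)%g (oct_move h s) = tile_fix g s.
Proof.
move=> gs; pose tr t := (phi h (t, s)).1.
have trE t : phi h (t, s) = (tr t, oct_move h s) by exact: phi_pair.
have tr_inj : injective tr.
  move=> t t' e; have := trE t; rewrite e -trE => /(congr1 (phi h^-1%g)).
  by rewrite -!phiM mulVg !phi1 => -[].
rewrite /tile_fix -[RHS](card_imset _ tr_inj) -[LHS]cardsE.
congr #|pred_of_set _|; apply/setP => u; rewrite inE.
apply/eqP/imsetP => [fix_u | [t]].
  set v := (phi h^-1%g (u, oct_move h s)).1.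
  have e : phi h^-1%g (u, oct_move h s) = (v, s).
    by rewrite phi_pair oct_moveK.
  exists v; last by rewrite /tr -e -phiM mulgV phi1.
  rewrite inE; apply/eqP; have := congr1 (phi h^-1%g) fix_u.
  by rewrite -phiM !mulgA mulVg mul1g phiM e.
rewrite inE => /eqP fix_t ->.
by rewrite -trE -phiM mulgKV phiM fix_t.
Qed.

Variables (s0 : octant) (r f : Oh).
Hypotheses (r_s0 : oct_move r s0 = s0) (f_s0 : oct_move f s0 = s0).
Hypotheses (r_rot : turn_order r = 3%N) (f_refl : turn_order f = 2%N).

Definition tile_count (k : nat) : nat :=
  if k == 1%N then #|T| else if k == 2%N then tile_fix f s0 else tile_fix r s0.

Lemma tile_fix_base g s : oct_move g s = s -> g != 1%g ->
  tile_fix g s =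
  tile_fix (if turn_order g == 2%N then base_refl else base_rot) Oh_one.1.
Proof.
move=> gs g1; have := stab_conj s g (introT eqP gs).
rewrite (negbTE g1 : g == Oh_one = false) => /hasP[h _ /andP[/eqP hs /eqP hg]].
set b := if _ then _ else _ in hg *.
have -> : g = (h * b * h^-1)%g by apply/(mulIg h); rewrite mulgKV.
by rewrite -hs tile_fix_conj // /b; case: ifP.
Qed.

Lemma tile_fixE g s :
  oct_move g s = s -> tile_fix g s = tile_count (turn_order g).
Proof.
move=> gs; have [-> | g1] := eqVneq g 1%g.
  by rewrite /tile_count /=; apply: eq_card => t; rewrite inE phi1 eqxx.
have neq1 h : turn_order h != 1%N -> h != 1%g by apply: contraNneq => ->.
rewrite tile_fix_base // /tile_count.
have : turn_order g \in [:: 2; 3]%N.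
  by rewrite /turn_order (negbTE g1 : g == Oh_one = false); case: ifP.
rewrite !inE => /orP[] /eqP-> /=.
  by rewrite (tile_fix_base f) ?f_refl // neq1 ?f_refl.
by rewrite (tile_fix_base r) ?r_rot // neq1 ?r_rot.
Qed.

(** The inverse of g moves the tiling, so that this is a right action. *)
Definition retile (tau : {ffun octant -> T}) (g : Oh) : {ffun octant -> T} :=
  [ffun s => (phi g^-1%g (tau (oct_move g s), oct_move g s)).1].

Lemma retile1 : retile^~ 1%g =1 id.
Proof. by move=> tau; apply/ffunP => s; rewrite ffunE invg1 phi1 oct_move1. Qed.

Lemma retileM tau : act_morph retile tau.
Proof.
move=> g h; apply/ffunP => s; rewrite !ffunE invMg phiM oct_moveM.
by congr (phi _ _).1; rewrite phi_pair oct_moveK.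
Qed.

Definition tiling_action := TotalAction retile1 retileM.

Lemma retile_fixP tau g :
  (tau \in 'Fix_tiling_action[g]%g)
  = fixed_section _ _ (oct_move g) (phi g) tau.
Proof.
apply/afix1P/forallP => [fix_tau s | fix_tau].
  rewrite -{1}fix_tau /= ffunE; apply/eqP.
  have := phi_pair g^-1%g (tau (oct_move g s)) (oct_move g s).
  by rewrite oct_moveK => <-; rewrite -phiM mulgV phi1.
apply/ffunP => s; rewrite /= ffunE -(eqP (fix_tau s)) -phiM.
by rewrite mulVg phi1.
Qed.

Lemma Oh_expE g n : Oh_exp g n = (g ^+ n)%g.
Proof. by elim: n => // n IHn; rewrite expgS -IHn. Qed.

Lemma iter_move n g s : iter n (oct_move g) s = oct_move (g ^+ n)%g s.
Proof.
by elim: n => [|n IHn]; rewrite ?oct_move1 // expgS oct_moveM -IHn.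
Qed.

Lemma iter_phi n g p : iter n (phi g) p = phi (g ^+ n)%g p.
Proof. by elim: n => [|n IHn]; rewrite ?phi1 // expgS phiM -IHn. Qed.

Lemma card_Fix g :
  #|('Fix_tiling_action[g])%g| = (\prod_(k <- cycle_type g) tile_count k)%N.
Proof.
rewrite (eq_card (retile_fixP^~ g)).
rewrite (card_fixed_sections _ _ _ (cycle_rep g)); first last.
- by move=> s; have /and4P[_ _ /eqP] := cycle_dataP g s.
- exact: cycle_rep_conn.
- exact: phi_over.
- exact: can_inj (oct_moveK g).
rewrite /cycle_type (perm_big _ (permEl (perm_sort leq _))) big_map big_filter.
rewrite (perm_big _ enum_octants); apply: eq_bigr => s _.
have /and4P[_ /eqP closed _ _] := cycle_dataP g s.
rewrite Oh_expE -(tile_fixE _ s); last by rewrite -iter_move.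
by rewrite order_period; apply: eq_card => t; rewrite !inE iter_phi.
Qed.

Definition tiling_number :=
  #|orbit tiling_action [set: Oh] @: [set: {ffun octant -> T}]|.

Lemma tiling_numberE : (tiling_number * 48 =
  \sum_(c <- cycle_index) \prod_(k <- c) tile_count k)%N.
Proof.
have acts_all : [acts [set: Oh], on [set: {ffun octant -> T}] | tiling_action].
  by apply/actsP => g _ tau; rewrite !inE.
have cardOh : #|[set: Oh]| = 48%N.
  by rewrite cardsT !card_prod card_bool card_ord.
rewrite -{1}cardOh -(Frobenius_Cauchy acts_all) -(perm_big _ cycle_types).
rewrite big_map -(perm_big _ enum_Oh).
apply: eq_big => [g | g _]; first by rewrite inE.
by rewrite finset.setTI card_Fix.
Qed.

End Burnside.

Lemma cycle_index_eval (t : nat -> nat) :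
  (\sum_(c <- cycle_index) \prod_(k <- c) t k =
   t 1 ^ 8 + 6 * t 1 ^ 2 + 3 * t 1 ^ 4 + 8 * t 1 ^ 2 * t 3 ^ 2
   + 6 * t 1 ^ 4 + t 1 ^ 4 + 6 * t 1 ^ 2 + 3 * t 1 ^ 4
   + 8 * t 1 * t 3 + 6 * t 1 ^ 2 * t 2 ^ 4)%N.
Proof.
rewrite /cycle_index !big_cat !big_nseq !iter_addn !big_cons !big_nil /=.
ring.
Qed.

Local Open Scope classical_set_scope.
Local Open Scope card_scope.

(** * The faces of the octahedron *)

Section Faces.
Variable R : realType.
Notation V := 'cV[R]_3.
Notation P := (octahedron R).
Notation Mx := (Oh_mx R).

Lemma signed_perm_mxP A : signed_perm_mx R A <-> exists g, A = Mx g.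
Proof.
have ordE d (s : 'S_3) i j :
    (diag_mx d *m perm_mx s) i j = d 0 i *+ (s i == j) :> R.
  by rewrite mul_diag_mx !mxE mulr_natr.
split=> [[d [s [d1 ->]]] | [g ->]].
  have [p axisE] := axis_onto s (@perm_inj _ s).
  exists (octant_of (fun i => d 0 i == -1), p); apply/matrixP => i j.
  rewrite ordE mxE axisE osignE; congr (_ *+ _).
  by case: (d1 i) => ->;
    rewrite ?eqxx // -subr_eq0 opprK -[_ + _]/(2%:R) pnatr_eq0.
exists (\row_i (-1) ^+ osign g.1 i), (perm (@axis_inj g)); split=> [i|].
  by rewrite mxE; case: osign; [right | left].
by apply/matrixP => i j; rewrite ordE !mxE permE.
Qed.

Lemma signed_perm_Oh g : signed_perm_mx R (Mx g).
Proof. by apply/signed_perm_mxP; exists g. Qed.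

Lemma dot_Oh_mx g u v : dot (Mx g *m u) (Mx g *m v) = dot u v.
Proof.
rewrite /dot [RHS](reindex_inj (@axis_inj g)); apply: eq_bigr => i _.
by rewrite !Oh_mxE mulrACA -expr2 sqrr_sign mul1r.
Qed.

Definition vertex (s : octant) (i : 'I_3) : V :=
  (-1) ^+ osign s i *: delta_mx i 0.

Definition normal (s : octant) : V := \col_i (-1) ^+ osign s i.

Definition octant_face (s : octant) : set V :=
  P `&` [set x | dot (normal s) x = 1].

Lemma Oh_vertex g s i :
  Mx g *m vertex s (axis g i) = vertex (oct_move g s) i.
Proof.
apply/matrixP => k l; rewrite Oh_mxE !mxE (inj_eq (@axis_inj g)) osign_moveE.
by have [->|_] := eqVneq k i; rewrite ?mulr0 // mulrA signr_addb.
Qed.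

Lemma Oh_normal g s : Mx g *m normal s = normal (oct_move g s).
Proof.
by apply/matrixP => i j; rewrite Oh_mxE !mxE osign_moveE signr_addb.
Qed.

Lemma tr_mul_dot (u v : V) : u^T *m v = (dot u v)%:M.
Proof.
apply/matrixP => i j; rewrite !ord1 !mxE mulr1n.
by apply: eq_bigr => k _; rewrite mxE.
Qed.

Lemma dot_vertex (c : V) s i :
  dot c (vertex s i) = (-1) ^+ osign s i * c i 0.
Proof.
rewrite /dot (bigD1 i) //= big1 ?addr0 => [|j ji];
  rewrite !mxE ?eqxx ?mulr1 1?mulrC //.
by rewrite (negbTE ji) mulr0 mul0r.
Qed.

Lemma octahedron_vertex s i : P (vertex s i).
Proof.
exists 1%N, (fun=> vertex s i), (fun=> 1).
split=> //; rewrite ?big_ord1 ?scale1r //.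
(* the permutation i - _ exchanges the axes 0 and i *)
move=> _; exists (Mx (octant_of (fun=> osign s i), (i, true))).
  exact: signed_perm_Oh.
apply/matrixP => k l; rewrite Oh_mxE osignE !mxE /axis /= subr_eq0 (eq_sym i).
by rewrite !ord1.
Qed.

Lemma octahedron_Oh g x : P x -> P (Mx g *m x).
Proof.
move=> [n [p [w [Gp w0 w1 ->]]]].
exists n, (fun i => Mx g *m p i), w; split=> //; last first.
  by rewrite mulmx_sumr; apply: eq_bigr => i _; rewrite scalemxAr.
move=> i; have [_ /signed_perm_mxP[h ->] <-] := Gp i.
by exists (Mx (g * h)%g); [exact: signed_perm_Oh | rewrite Oh_mxM mulmxA].
Qed.

(** Half of the fact that the octahedron is the unit ball of the l1 norm: it
    bounds a linear form on the octahedron by the largest absolute value of its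
    coefficients, and by [octahedron_vertex] the bound is attained. *)
Lemma octahedron_l1 x : P x -> \sum_i `|x i 0| <= 1.
Proof.
move=> [n [p [w [Gp w0 w1 ->]]]]; rewrite -w1.
under eq_bigr => i _ do rewrite summxE.
apply: (@le_trans _ _ (\sum_i \sum_k w k * `|p k i 0|)).
  apply: ler_sum => i _; apply: le_trans (ler_norm_sum _ _ _) _.
  by apply: ler_sum => k _; rewrite mxE normrM ger0_norm.
rewrite exchange_big; apply: ler_sum => k _ /=.
rewrite -mulr_sumr -[leRHS]mulr1 ler_wpM2l //.
have [_ /signed_perm_mxP[g ->] <-] := Gp k.
rewrite (bigD1 (axis g^-1%g 0)) //= big1 => [|i ne_i].
  by rewrite addr0 Oh_mxE normrMsign mxE; case: (_ && _);
    rewrite ?normr1 ?normr0.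
rewrite Oh_mxE normrMsign mxE; case: eqP => [ax0 | _]; last by rewrite normr0.
by rewrite -ax0 axisK eqxx in ne_i.
Qed.

(** The slack of a supporting inequality controls the coordinates whose
    coefficient is not extremal: they vanish where equality holds. *)
Lemma octahedron_gap (c x : V) m : (forall i, `|c i 0| <= m) -> P x ->
  \sum_i (m - `|c i 0|) * `|x i 0| <= m - dot c x.
Proof.
move=> cm Px; under eq_bigr => i _ do rewrite mulrBl.
rewrite sumrB lerB //.
  rewrite -mulr_sumr -[leRHS]mulr1 ler_wpM2l ?octahedron_l1 //.
  exact: le_trans (normr_ge0 _) (cm 0).
by apply: ler_sum => i _; rewrite -normrM ler_norm.
Qed.

Lemma octahedron_dot_le (c x : V) m :
  (forall i, `|c i 0| <= m) -> P x -> dot c x <= m.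
Proof.
move=> cm Px; rewrite -subr_ge0; apply: le_trans (octahedron_gap _ _ _ cm Px).
by apply: sumr_ge0 => i _; rewrite mulr_ge0 // subr_ge0.
Qed.

Lemma octant_face_vertex s i : octant_face s (vertex s i).
Proof.
split; first exact: octahedron_vertex.
by rewrite /= dot_vertex mxE -expr2 sqrr_sign.
Qed.

Lemma octant_face_inj : injective octant_face.
Proof.
move=> s t e; apply: osign_inj => i.
have := octant_face_vertex s i; rewrite e => -[_ /=].
rewrite dot_vertex mxE -signr_addb => /(@signr_inj _ _ false).
by case: (osign s i) (osign t i) => -[].
Qed.

Lemma octant_face_Oh g s :
  mulmx (Mx g) @` octant_face s = octant_face (oct_move g s).
Proof.
have sub h t x : octant_face t x -> octant_face (oct_move h t) (Mx h *m x).
  move=> [Px xt]; split; first exact: octahedron_Oh.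
  by rewrite /= -Oh_normal dot_Oh_mx.
apply/seteqP; split=> [_ [x sx <-] | x gsx]; first exact: sub.
exists (Mx g^-1%g *m x); first by rewrite -[s](oct_moveK g); apply: sub.
by rewrite mulmxA -Oh_mxM -[Oh_mul _ _]/(g * g^-1)%g mulgV Oh_mx1 mul1mx.
Qed.

Lemma faces_octant_face s : faces P (octant_face s).
Proof.
exists (normal s), 1; split=> //.
- by apply/eqP => /matrixP/(_ 0 0)/eqP; rewrite !mxE signr_eq0.
- move=> x; apply: octahedron_dot_le => i.
  by rewrite mxE normrX normrN1 expr1n.
exists (vertex s 0), (vertex s 1), (vertex s 2).
split; try exact: octant_face_vertex.
(* the signed coordinates 1 and 2 are a left inverse of the matrix of edges *)
apply/eqP; rewrite -[_ == _]/(row_full _); apply/row_fullP.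
pose coord i : 'rV[R]_3 := (-1) ^+ osign s i *: delta_mx 0 i.
exists (col_mx (coord 1) (coord 2)).
have coordE i (v : V) : coord i *m v = ((-1) ^+ osign s i * v i 0)%:M.
  apply/matrixP => k l.
  by rewrite -scalemxAl -rowE !mxE !ord1 mulr1n.
rewrite mul_col_row !coordE !mxE /= !(mulr0, mulr1, subr0, sub0r, oppr0).
by rewrite -!expr2 !sqrr_sign [in RHS]scalar_mx_block raddf0.
Qed.

(** Let c.x = m define a supporting plane; evaluation at the vertices gives
    |c_i| <= m.  If |c_j| < m for some j, then x_j = 0 on the face by
    [octahedron_gap], so the face lies on the intersection of two planes and
    cannot contain three affinely independent points.  Hence every |c_i| is m
    and c is m times a sign vector. *)
Lemma faceP F : faces P F -> exists s, F = octant_face s.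
Proof.
move=> [c [m [c0 cm -> [p [q [r [[Pp /= cp] [Pq /= cq] [Pr /= cr] rank2]]]]]]].
have abs_cm i : `|c i 0| <= m.
  have vert (b : bool) : (-1) ^+ b * c i 0 <= m.
    have := cm _ (octahedron_vertex (b, b, b) i); rewrite dot_vertex.
    by have := in_ord3 i; rewrite !inE => /or3P[] /eqP->.
  by have := vert true; have := vert false; rewrite ler_norml; lra.
have m_gt0 : 0 < m.
  rewrite lt_neqAle (le_trans (normr_ge0 _) (abs_cm 0)) andbT.
  apply: contraNneq c0 => m0; apply/eqP/matrixP => i j; rewrite ord1 mxE.
  by apply/eqP; rewrite -normr_le0 m0.
have coord0 x j : P x -> dot c x = m -> `|c j 0| < m -> x j 0 = 0.
  move=> Px cx cj; have := octahedron_gap _ _ _ abs_cm Px.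
  have terms i : 0 <= (m - `|c i 0|) * `|x i 0|.
    by rewrite mulr_ge0 // subr_ge0.
  rewrite cx subrr => le0.
  have sum0 : \sum_i (m - `|c i 0|) * `|x i 0| = 0.
    by apply/eqP; rewrite eq_le le0 sumr_ge0.
  have /eqP : (m - `|c j 0|) * `|x j 0| = 0 by apply: (psumr_eq0P _ sum0).
  by rewrite mulf_eq0 subr_eq0 gt_eqF //= normr_eq0 => /eqP.
have abs_c j : `|c j 0| = m.
  apply/eqP; rewrite eq_le abs_cm leNgt; apply/negP => cj.
  have [i ij ci0] : exists2 i, i != j & c i 0 != 0.
    apply/exists_inP; apply: contraTT m_gt0 => /exists_inPn c0'.
    rewrite -cp /dot (bigD1 j) //= (coord0 p j) // mulr0 add0r.
    rewrite big1 ?ltxx // => i ij.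
    by have /negPn/eqP-> := c0' i ij; rewrite mul0r.
  pose A := row_mx (q - p) (r - p).
  pose K : 'M_(1 + 1, 3) := col_mx c^T (delta_mx 0 j).
  have kill_c x y : dot c x = m -> dot c y = m -> c^T *m (x - y) = 0.
    by move=> cx cy; rewrite mulmxBr !tr_mul_dot cx cy subrr.
  have kill_j x y : P x -> P y -> dot c x = m -> dot c y = m ->
      (delta_mx 0 j : 'rV_3) *m (x - y) = 0.
    move=> Px Py cx cy; rewrite -rowE; apply/matrixP => k l.
    by rewrite !ord1 !mxE (coord0 x) // (coord0 y) // subrr.
  have KA : K *m A = 0 by rewrite mul_col_row !kill_c // !kill_j // block_mx0.
  have K_free : row_free K.
    have c_delta l : c^T *m delta_mx l 0 = (c l 0)%:M.
      by rewrite -colE; apply/matrixP => k o; rewrite !ord1 !mxE mulr1n.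
    have j_delta l : (delta_mx 0 j : 'rV[R]_3) *m delta_mx l 0
        = (l == j)%:R%:M :> 'M_1.
      by rewrite -colE; apply/matrixP => k o; rewrite !ord1 !mxE mulr1n.
    apply/row_freeP; exists (row_mx ((c i 0)^-1 *: delta_mx i 0)
      (delta_mx j 0 - (c j 0 / c i 0) *: delta_mx i 0)).
    rewrite mul_col_row !mulmxBr -!scalemxAr !c_delta !j_delta.
    rewrite (negbTE ij) eqxx !scale_scalar_mx mulVf // divfK // subrr.
    by rewrite !mulr0 raddf0 subr0 [in RHS]scalar_mx_block.
  have := mulmx0_rank_max KA; rewrite rank2.
  by move: K_free; rewrite /row_free => /eqP ->.
exists (octant_of (fun i => c i 0 < 0)).
set s := octant_of _; have cE : c = m *: normal s.
  apply/matrixP => i k; rewrite ord1 !mxE osignE -(abs_c i) mulrC.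
  by rewrite -numEsign.
have dot_c x : dot c x = m * dot (normal s) x.
  by rewrite cE /dot mulr_sumr; apply: eq_bigr => i _; rewrite !mxE mulrA.
apply/seteqP; split=> x [Px /= xF]; split=> //=; last by rewrite dot_c xF mulr1.
by apply: (mulfI (lt0r_neq0 m_gt0)); rewrite mulr1 -dot_c.
Qed.

(** * Rotations and reflections of a face *)

Lemma dotBl (u v w : V) : dot (u - v) w = dot u w - dot v w.
Proof. by rewrite /dot -sumrB; apply: eq_bigr => i _; rewrite !mxE mulrBl. Qed.

Lemma dotC (u v : V) : dot u v = dot v u.
Proof. by apply: eq_bigr => i _; rewrite mulrC. Qed.

Lemma dotBr (u v w : V) : dot w (u - v) = dot w u - dot w v.
Proof. by rewrite dotC dotBl !(dotC w). Qed.

Lemma dotZl a (u v : V) : dot (a *: u) v = a * dot u v.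
Proof. by rewrite /dot mulr_sumr; apply: eq_bigr => i _; rewrite mxE mulrA. Qed.

Lemma dot_ge0 (u : V) : 0 <= dot u u.
Proof. by apply: sumr_ge0 => i _; rewrite -expr2 sqr_ge0. Qed.

Lemma dot_eq0 (u : V) : dot u u = 0 -> u = 0.
Proof.
move=> u0; apply/matrixP => i j; rewrite ord1 [RHS]mxE; apply/eqP.
rewrite -sqrf_eq0; apply/eqP; rewrite expr2.
by apply: (psumr_eq0P _ u0) => // k _; rewrite -expr2 sqr_ge0.
Qed.

Lemma stab_vertex g s i :
  oct_move g s = s -> Mx g *m vertex s (axis g i) = vertex s i.
Proof. by move=> gs; rewrite Oh_vertex gs. Qed.

Lemma Oh_fix_vertices g s :
  (forall i, Mx g *m vertex s i = vertex s i) -> g = 1%g.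
Proof.
move=> fix_v; apply: (@Oh_mx_inj R); rewrite -[1%g]/Oh_one Oh_mx1.
apply/matrixP => i j; have := fix_v j; rewrite /vertex -scalemxAr.
move=> /(scalerI (negbT (signr_eq0 _ _))); rewrite -colE => /matrixP/(_ i 0).
by rewrite !mxE andbT => ->.
Qed.

(** A rotation through 120 degrees fixes no vertex v_k: v_k would be the
    centre, and for another vertex v the vectors from v_k to v and to its image
    would make an angle of at most 60 degrees.  So it moves the three vertices
    cyclically. *)
Lemma rotates120_turn_order g s : oct_move g s = s ->
  rotates120 (octant_face s) (mulmx (Mx g)) -> turn_order g = 3%N.
Proof.
move=> gs [c _ rot]; apply: derangement_turn_order; apply/allP => k _.
apply/negP => /eqP gk; have [] := rot _ (octant_face_vertex s k).
have := stab_vertex g s k gs; rewrite gk => -> _ dot_c.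
have /eqP : vertex s k - c = 0 by apply: dot_eq0; lra.
rewrite subr_eq0 => /eqP c_vertex; rewrite -{}c_vertex {c dot_c} in rot.
have ik : k + 1 != k by rewrite -subr_eq0 addrC addKr.
set i := k + 1 in ik.
have gik : axis g i != k by rewrite -{1}gk (inj_eq (axis_inj g)).
(* v is the vertex on the axis g i, and its image is the one on the axis i *)
have [_] := rot _ (octant_face_vertex s (axis g i)); rewrite stab_vertex //.
have := dot_ge0 (vertex s (axis g i) - vertex s k).
move: (dot (_ (axis g i) - _) (_ (axis g i) - _)) => d d_ge0.
rewrite dotBr !dot_vertex !mxE !eqxx (eq_sym k) (negbTE ik) (negbTE gik).
rewrite !(mulr0, mulr1, subr0, sub0r, mulrN, opprK) andbT.
rewrite -(signr_addb _ (osign s k)) addbb.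
have [-> | _] := eqVneq (axis g i) i; last by rewrite !mulr0; lra.
by rewrite mulr1 -signr_addb addbb; lra.
Qed.

(** A reflection negates the component along its normal n, hence is an
    involution; it is not the identity, which would force the component along
    n of every vector of the plane of the face, and so of n itself, to
    vanish. *)
Lemma reflects_turn_order g s : oct_move g s = s ->
  reflects (octant_face s) (mulmx (Mx g)) -> turn_order g = 2%N.
Proof.
move=> gs [c [p [q [Fc Fp Fq pq]]]]; move def_n: (p - q) => n refl.
have n_neq0 : dot n n != 0.
  by apply: contraNneq pq => /dot_eq0/eqP; rewrite -def_n subr_eq0.
have on_face x : octant_face s x -> octant_face s (Mx g *m x).
  by move=> sx; rewrite -{1}gs -octant_face_Oh; exists x.
have anti x : octant_face s x -> dot (Mx g *m x - c) n = - dot (x - c) n.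
  by move=> sx; rewrite refl // !dotBl dotZl divfK //; ring.
have gg1 : (g * g)%g = 1%g.
  apply: (Oh_fix_vertices _ s) => i; have sv := octant_face_vertex s i.
  rewrite Oh_mxM -mulmxA (refl _ (on_face _ sv)) anti // refl //.
  by rewrite mulrN mulNr scaleNr opprK subrK.
have g1 : g != 1%g.
  apply: contraNneq n_neq0 => g1.
  have ortho x : octant_face s x -> dot (x - c) n = 0.
    by move=> sx; have := anti x sx; rewrite g1 -[1%g]/Oh_one Oh_mx1 mul1mx; lra.
  rewrite -{1}def_n (_ : p - q = (p - c) - (q - c)).
    by rewrite dotBl !ortho ?subrr.
  by rewrite opprB addrA subrK.
rewrite /turn_order (negbTE g1 : g == Oh_one = false).
by rewrite (introT eqP gg1 : Oh_mul g g == Oh_one).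
Qed.

End Faces.

(** * Tilings of the faces as tilings of the octants *)

Lemma card_eq_finset (U : finType) (A : {set U}) : [set` A] #= `I_#|A|.
Proof.
have -> : [set` A] = range (@enum_val U (mem A)).
  apply/seteqP; split=> [x Ax | _ [i _ <-]] /=; last exact: enum_valP.
  by exists (enum_rank_in Ax x); rewrite ?enum_rankK_in.
apply: card_eq_trans (_ : [set: 'I_#|A|] #= _).
  by apply: inj_card_eq => i j _ _; apply: enum_val_inj.
by rewrite card_eq_sym card_II.
Qed.

Section TileDesigns.
Variables (R : realType) (T : finType).
Variable act : 'M[R]_3 -> T * faces (octahedron R) -> T * faces (octahedron R).
Hypothesis designs : tile_designs (signed_perm_mx R) act.
Notation Mx := (Oh_mx R).

Definition face (s : octant) : faces (octahedron R) :=
  SigSub (mem_set (faces_octant_face R s)).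

Lemma face_inj : injective face.
Proof. by move=> s t /(congr1 val)/octant_face_inj. Qed.

Lemma face_onto F : exists s, F = face s.
Proof.
have [s sF] := faceP R (val F) (set_mem (valP F)).
by exists s; apply: val_inj.
Qed.

Definition tile_move (g : Oh) (p : T * octant) : T * octant :=
  ((act (Mx g) (p.1, face p.2)).1, oct_move g p.2).

Lemma act_face g t s :
  act (Mx g) (t, face s) = ((tile_move g (t, s)).1, face (oct_move g s)).
Proof.
rewrite [LHS]surjective_pairing; congr (_, _); apply: val_inj.
by rewrite (tile_act_over designs (signed_perm_Oh R g)) octant_face_Oh.
Qed.

Lemma tile_move1 p : tile_move 1%g p = p.
Proof.
rewrite /tile_move oct_move1 -[1%g]/Oh_one Oh_mx1 (tile_act1 designs).
by case: p.
Qed.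

Lemma tile_moveM g h p : tile_move (g * h)%g p = tile_move g (tile_move h p).
Proof.
rewrite /tile_move oct_moveM -[(g * h)%g]/(Oh_mul g h) Oh_mxM.
rewrite (tile_actM designs (signed_perm_Oh R g) (signed_perm_Oh R h)).
by case: p => t s; rewrite act_face.
Qed.

Lemma tile_move_over g p : (tile_move g p).2 = oct_move g p.2.
Proof. by []. Qed.

Lemma tile_fix_face g s : oct_move g s = s ->
  tile_fix T tile_move g s = fixed_tiles act (Mx g) (face s).
Proof.
move=> gs; apply: eq_card => t; rewrite !inE; apply/eqP/asboolP.
  by rewrite act_face gs => ->.
by rewrite act_face gs => -[e]; rewrite /tile_move /= gs -{2}e.
Qed.

Definition on_octants (tau : tiling (octahedron R) T) : {ffun octant -> T} :=
  [ffun s => tau (face s)].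

Lemma on_octants_onto h : exists tau, on_octants tau = h.
Proof.
have [oct octP] := choice face_onto.
exists (fun F => h (oct F)); apply/ffunP => s; rewrite ffunE; congr (h _).
by apply: face_inj; rewrite -octP.
Qed.

Notation toA := (tiling_action T tile_move tile_move1 tile_moveM tile_move_over).

Lemma graph_image g tau tau' :
  graph_of tau' = act (Mx g) @` graph_of tau <->
  on_octants tau = toA (on_octants tau') g.
Proof.
split=> [e | e].
  apply/ffunP => s; rewrite !ffunE.
  have : graph_of tau' (act (Mx g) (tau (face s), face s)).
    by rewrite e; exists (tau (face s), face s).
  rewrite act_face /graph_of /= => <-.
  rewrite -[RHS]/(tile_move g^-1%g (tile_move g (tau (face s), s))).1.
  by rewrite -tile_moveM mulVg tile_move1.
have tau'E s : act (Mx g) (tau (face s), face s)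
             = (tau' (face (oct_move g s)), face (oct_move g s)).
  rewrite act_face; congr (_, _); have /ffunP/(_ s) := e; rewrite !ffunE => ->.
  rewrite -[X in tile_move g (_, X)](oct_moveK g).
  set p := (tau' (face (oct_move g s)), oct_move g s).
  rewrite -[oct_move g^-1%g _]/((tile_move g^-1%g p).2).
  by rewrite -surjective_pairing -tile_moveM mulgV tile_move1.
apply/seteqP; split=> [[t F] | _ [[t F] def_t <-]]; last first.
  by rewrite (def_t : t = tau F); have [s ->] := face_onto F; rewrite tau'E.
rewrite /graph_of /= => ->; have [s ->] := face_onto F.
pose u := oct_move g^-1%g s; exists (tau (face u), face u) => //.
by rewrite tau'E -oct_moveM mulgV oct_move1.
Qed.

Lemma tiling_orbitE tau : tiling_orbit (signed_perm_mx R) act tau =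
  [set tau' | on_octants tau' \in orbit toA [set: Oh]%SET (on_octants tau)].
Proof.
apply/seteqP; split=> tau' /=.
  move=> [_ /signed_perm_mxP[g ->] /graph_image e].
  by rewrite orbit_sym; apply/orbitP; exists g; rewrite ?finset.in_setT.
rewrite orbit_sym => /orbitP[g _ e].
by exists (Mx g); [exact: signed_perm_Oh | apply/graph_image].
Qed.

Lemma card_tiling_orbits : tiling_orbits (signed_perm_mx R) act #=
  `I_(tiling_number T tile_move tile_move1 tile_moveM tile_move_over).
Proof.
pose tilings_of (O : {set {ffun octant -> T}}) :=
  [set tau | on_octants tau \in O].
set orbits := (orbit toA [set: Oh]%SET @: [set: {ffun octant -> T}]%SET)%SET.
have -> : tiling_orbits (signed_perm_mx R) act = tilings_of @` [set` orbits].
  apply/seteqP; split=> [_ [tau _ <-] | _ [_ /imsetP[h _ ->] <-]].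
    exists (orbit toA [set: Oh]%SET (on_octants tau)).
      by apply/imsetP; exists (on_octants tau); rewrite ?finset.in_setT.
    by rewrite tiling_orbitE.
  have [tau <-] := on_octants_onto h.
  by exists tau => //; rewrite tiling_orbitE.
apply: card_eq_trans (card_eq_finset _ orbits).
apply: inj_card_eq => O O' _ _ e.
apply/setP => h; have [tau <-] := on_octants_onto h.
have : tilings_of O tau = tilings_of O' tau by rewrite e.
by rewrite /tilings_of /= => {}e; apply/idP/idP; rewrite e.
Qed.

End TileDesigns.

Theorem theorem4 (R : realType) (T : finType)
    (act : 'M[R]_3 -> T * faces (octahedron R) -> T * faces (octahedron R))
    (F : faces (octahedron R)) (r f : 'M[R]_3) (tid tr tf : nat) :
  tile_designs (signed_perm_mx R) act ->
  stabilizer (signed_perm_mx R) (val F) r -> rotates120 (val F) (mulmx r) ->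
  stabilizer (signed_perm_mx R) (val F) f -> reflects (val F) (mulmx f) ->
  tid = #|T| -> tr = fixed_tiles act r F -> tf = fixed_tiles act f F ->
  exists N : nat,
    [/\ tiling_orbits (signed_perm_mx R) act #= `I_N,
        N%:R = 1 / 48 *
          (tid ^ 8 + 6 * tid ^ 2 + 3 * tid ^ 4 + 8 * tid ^ 2 * tr ^ 2
           + 6 * tid ^ 4 + tid ^ 4 + 6 * tid ^ 2 + 3 * tid ^ 4
           + 8 * tid * tr + 6 * tid ^ 2 * tf ^ 4)%N%:R :> rat
      & N%:R = 1 / 48 *
          (tid ^ 8 + 13 * tid ^ 4 + 12 * tid ^ 2 + 8 * tid ^ 2 * tr ^ 2
           + 8 * tid * tr + 6 * tid ^ 2 * tf ^ 4)%N%:R :> rat].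
Proof.
move=> designs [/signed_perm_mxP[a ->] aF] rot_a.
move=> [/signed_perm_mxP[b ->] bF] refl_b -> {tid}.
have [s defF] := face_onto R F; rewrite {F}defF /= in aF rot_a bF refl_b *.
have stab g : mulmx (Oh_mx R g) @` octant_face R s = octant_face R s ->
    oct_move g s = s.
  by rewrite octant_face_Oh => /octant_face_inj.
have [as_ bs] := (stab a aF, stab b bF).
rewrite -!tile_fix_face // => -> ->.
have count := tiling_numberE T _ (tile_move1 _ _ _ designs)
  (tile_moveM _ _ _ designs) (tile_move_over _ _ act) s a b as_ bs
  (rotates120_turn_order R a s as_ rot_a)
  (reflects_turn_order R b s bs refl_b).
set N := tiling_number _ _ _ _ _ in count; exists N.
rewrite cycle_index_eval /tile_count /= in count.
have div48 m : (N * 48 = m)%N -> N%:R = 1 / 48 * m%:R :> rat.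
  by move=> <-; rewrite natrM mulrCA mul1r mulVf ?mulr1.
split; [exact: card_tiling_orbits | exact: div48 | apply: div48].
by rewrite count; ring.
Qed.
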